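(* Let $\pi$ be a finitely refining sequence of partitions of $[0,1]$ and $x\in C^0([0,1],\mathbb R)$. Define for all $m\ge0$, $0\le k\le N(\pi^{m+1})-N(\pi^m)-1$, writing $t_j=t^{m,k}_j$, $$\theta_{m,k}=\frac{(x(t_2)-x(t_1))(t_3-t_2)-(x(t_3)-x(t_2))(t_2-t_1)}{\sqrt{(t_2-t_1)(t_3-t_2)(t_3-t_1)}}.$$ Then $$x(t)=x(0)+(x(1)-x(0))t+\sum_{m=0}^{\infty}\sum_{k=0}^{N(\pi^{m+1})-N(\pi^m)-1}\theta_{m,k}e^\pi_{m,k}(t),$$ where the partial sums over $m\le N-1$ converge to $x$ uniformly on $[0,1]$ as $N\to\infty$. Moreover this representation is unique: if $x(t)=x(0)+(x(1)-x(0))t+\sum_m\sum_k\theta'_{m,k}e^\pi_{m,k}(t)$ for all $t$ with real coefficients $\theta'_{m,k}$, then $\theta'_{m,k}=\theta_{m,k}$ for all $m,k$.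
   Context: A partition of $[0,1]$ is a finite set $\{0=t_0<t_1<\dots<t_N=1\}$; for a partition $\pi^n=\{0=t^n_0<\dots<t^n_{N(\pi^n)}=1\}$, $N(\pi^n)$ is its number of intervals, $|\pi^n|=\max_i(t^n_{i+1}-t^n_i)$ and $\underline{\pi^n}=\min_i(t^n_{i+1}-t^n_i)$. A sequence $\pi=(\pi^n)_{n\ge0}$ of partitions of $[0,1]$, with the convention $\pi^0=\{0,1\}$, is finitely refining if $\pi^n\subseteq\pi^{n+1}$ for all $n$, $|\pi^n|\to0$, and there is $M<\infty$ such that for every $n$ each interval $[t^n_i,t^n_{i+1}]$ contains at most $M$ points of $\pi^{n+1}$. Haar and Schauder functions of a finitely refining $\pi$: for each level $m\ge0$ and each interval $[u_0,u_r]$ of $\pi^m$, let $u_0<u_1<\dots<u_r$ be the points of $\pi^{m+1}$ lying in $[u_0,u_r]$. For each $i\in\{2,\dots,r\}$ put $t_1=u_0$, $t_2=u_{i-1}$, $t_3=u_i$ and define $\psi(s)=\sqrt{\frac{t_3-t_2}{(t_2-t_1)(t_3-t_1)}}$ for $s\in[t_1,t_2)$, $\psi(s)=-\sqrt{\frac{t_2-t_1}{(t_3-t_2)(t_3-t_1)}}$ for $s\in[t_2,t_3)$, $\psi(s)=0$ otherwise, and $e(t)=\int_0^t\psi(s)\,ds$ (a continuous hat function vanishing outside $[t_1,t_3]$, affine on $[t_1,t_2]$ and on $[t_2,t_3]$, maximal at $t_2$). Ranging over all intervals of $\pi^m$ and all such $i$ gives $N(\pi^{m+1})-N(\pi^m)$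 functions at level $m$, enumerated in a fixed order as $\psi_{m,k}$, $e^\pi_{m,k}$, $k=0,\dots,N(\pi^{m+1})-N(\pi^m)-1$, with associated points $t^{m,k}_1<t^{m,k}_2<t^{m,k}_3$ (so $[t^{m,k}_1,t^{m,k}_3]$ is the support of $e^\pi_{m,k}$ and $t^{m,k}_2$ its maximum point). The $\psi_{m,k}$ are the Haar functions and the $e^\pi_{m,k}$ the Schauder functions of $\pi$. *)

(* Defs.v *)
From HB Require Import structures.
From mathcomp Require Import all_boot all_order all_algebra.
From mathcomp Require Import all_classical all_reals all_analysis.
Set Implicit Arguments. Unset Strict Implicit. Unset Printing Implicit Defensive.
Import Order.TTheory GRing.Theory Num.Theory.
Import numFieldNormedType.Exports.
Local Open Scope classical_set_scope.
Local Open Scope ring_scope.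

Section Defs.
Variable R : realType.

Definition is_partition (p : seq R) : Prop :=
  [/\ sorted <%R p, (1 < size p)%N, head 0 p = 0 & last 0 p = 1].

Definition nintervals (p : seq R) : nat := (size p).-1.

Definition mesh (p : seq R) : R :=
  \big[Num.max/0]_(i < nintervals p) (nth 0 p i.+1 - nth 0 p i).

Definition finitely_refining (P : nat -> seq R) : Prop :=
  [/\ P 0%N = [:: 0; 1],
      (forall n, is_partition (P n)),
      (forall n, {subset P n <= P n.+1}),
      mesh \o P @ \oo --> (0 : R)
    & exists M : nat, forall n i, (i < nintervals (P n))%N ->
        (count (fun s : R => (nth 0%R (P n) i <= s)%R && (s <= nth 0%R (P n) i.+1)%R)
               (P n.+1) <= M)%N].

Definition points_in (q : seq R) (a b : R) : seq R :=
  [seq s <- q | (a <= s) && (s <= b)].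

Definition interval_triples (q : seq R) (a b : R) : seq (R * R * R) :=
  let us := points_in q a b in
  [seq (nth 0 us 0, nth 0 us i.-1, nth 0 us i) | i <- iota 2 ((size us).-1.-1)].

Definition level_triples (P : nat -> seq R) (m : nat) : seq (R * R * R) :=
  flatten [seq interval_triples (P m.+1) (nth 0 (P m) i) (nth 0 (P m) i.+1)
          | i <- iota 0 (nintervals (P m))].

Definition triple (P : nat -> seq R) (m k : nat) : R * R * R :=
  nth (0, 0, 0) (level_triples P m) k.

Definition haar (tr : R * R * R) (s : R) : R :=
  let: (t1, t2, t3) := tr in
  if (t1 <= s) && (s < t2) then
    Num.sqrt ((t3 - t2) / ((t2 - t1) * (t3 - t1)))
  else if (t2 <= s) && (s < t3) then
    - Num.sqrt ((t2 - t1) / ((t3 - t2) * (t3 - t1)))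
  else 0.

Definition schauder (tr : R * R * R) (t : R) : R :=
  Rintegral lebesgue_measure `[0, t] (haar tr).

Definition haar_fun (P : nat -> seq R) (m k : nat) : R -> R := haar (triple P m k).
Definition schauder_fun (P : nat -> seq R) (m k : nat) : R -> R :=
  schauder (triple P m k).

Definition theta (P : nat -> seq R) (x : R -> R) (m k : nat) : R :=
  let: (t1, t2, t3) := triple P m k in
  ((x t2 - x t1) * (t3 - t2) - (x t3 - x t2) * (t2 - t1)) /
  Num.sqrt ((t2 - t1) * (t3 - t2) * (t3 - t1)).

Definition schauder_partial (P : nat -> seq R) (x : R -> R)
    (c : nat -> nat -> R) (N : nat) (t : R) : R :=
  x 0 + (x 1 - x 0) * t +
  \sum_(m < N) \sum_(k < (nintervals (P m.+1) - nintervals (P m))%N)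
      c m k * schauder_fun P m k t.

End Defs.

(* Main.v *)
Require Import Defs.
From HB Require Import structures.
From mathcomp Require Import all_boot all_order all_algebra.
From mathcomp Require Import all_classical all_reals all_analysis.
From mathcomp Require Import ring lra zify.
Import Order.TTheory GRing.Theory Num.Theory.
Import numFieldNormedType.Exports.
Local Open Scope classical_set_scope.
Local Open Scope ring_scope.

(** At level [m] the partial sum of the series is the piecewise affine
    interpolation of [x] on [P m]: inside an interval of [P m], adding the hats
    with coefficients [theta] from the last to the first inserts the new points
    one by one, each time replacing a chord of [x] by two chords. Uniform
    convergence is then uniform continuity of [x]. For uniqueness, hats of
    level at least [n] vanish on [P n], so the values of [x] on [P m.+1]
    determine the partial sum up to level [m] there; the level-[m]
    coefficients follow because evaluation at the maxima of the hats is a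
    triangular system. *)

(** * Schauder functions in closed form *)

(** The domain meets [[a, b[] in nothing, in [[a, t]] or in all of [[a, b[]; clamping [t] to
    [[a, b]] covers the three cases in one formula. *)
Lemma Rintegral_indic_itvco {R : realType} (a b t : R) : 0 <= a -> a < b ->
  0 <= t ->
  Rintegral lebesgue_measure `[0, t] (\1_`[a, b[) =
  Num.min (Num.max t a) b - a.
Proof.
move=> a0 ab t0; rewrite /Rintegral integral_indic//.
have [ta|ta] := ltP t a.
  rewrite (_ : _ `&` _ = set0) ?measure0 ?min_l ?subrr 1?ltW//.
  by rewrite -subset0 => s /=; rewrite !in_itv/= => -[/andP[? _] /andP[_ ?]]; lra.
have [tb|tb] := ltP t b.
  rewrite (_ : _ `&` _ = [set` `[a, t]]); last first.
    rewrite eqEsubset; split=> s /=; rewrite !in_itv/=.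
      by move=> [/andP[-> _] /andP[_ ->]].
    by move=> /andP[? ?]; split; apply/andP; split; lra.
  rewrite [X in fine X](lebesgue_measure_itv `[a, t])/= lte_fin; case: ltP => //= h; lra.
rewrite (_ : _ `&` _ = [set` `[a, b[]); last first.
  rewrite eqEsubset; split=> s /=; rewrite !in_itv/=; first by case.
  by move=> /andP[? ?]; split; apply/andP; split; lra.
by rewrite [X in fine X](lebesgue_measure_itv `[a, b[)/= lte_fin ab.
Qed.

Lemma haar_indicE {R : realType} (t1 t2 t3 : R) : t1 < t2 -> t2 < t3 ->
  haar (t1, t2, t3) =
  (fun s => Num.sqrt ((t3 - t2) / ((t2 - t1) * (t3 - t1))) * \1_`[t1, t2[ s
          - Num.sqrt ((t2 - t1) / ((t3 - t2) * (t3 - t1))) * \1_`[t2, t3[ s).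
Proof.
move=> t12 t23; apply/funext => s.
rewrite /haar !indicE !mem_setE !in_itv/=.
have [|st2] := boolP (_ && _) => [/andP[_ st2]|].
  by rewrite leNgt st2/= mulr1 mulr0 subr0.
by case: ifP => _; rewrite ?mulr1 !mulr0 ?sub0r ?oppr0.
Qed.

Lemma schauder_clampE {R : realType} (t1 t2 t3 t : R) :
  0 <= t1 -> t1 < t2 -> t2 < t3 -> 0 <= t ->
  schauder (t1, t2, t3) t =
  Num.sqrt ((t3 - t2) / ((t2 - t1) * (t3 - t1))) *
    (Num.min (Num.max t t1) t2 - t1)
  - Num.sqrt ((t2 - t1) / ((t3 - t2) * (t3 - t1))) *
    (Num.min (Num.max t t2) t3 - t2).
Proof.
move=> t10 t12 t23 t0; rewrite /schauder haar_indicE//.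
have int a b : lebesgue_measure.-integrable `[0, t] (EFin \o \1_`[a, b[).
  by apply: integrableS (integrable_indic_itv a b true true).
have intZ c a b : lebesgue_measure.-integrable `[0, t]
    (EFin \o (fun s => c * \1_`[a, b[ s)).
  by apply: eq_integrable (integrableZl _ c (int a b)).
rewrite RintegralB// !RintegralZl// !Rintegral_indic_itvco//; lra.
Qed.

(* Both slopes of a Schauder function share the numerator of its normalisation. *)
Lemma sqrt_ratioE {R : realType} (p q : R) : 0 < p -> 0 < q ->
  Num.sqrt (q / (p * (p + q))) = Num.sqrt (p * q * (p + q)) / (p * (p + q)).
Proof.
move=> p0 q0; apply/eqP; rewrite -(@eqrXn2 _ 2)// ?sqrtr_ge0//; last first.
  by rewrite divr_ge0 ?sqrtr_ge0// ltW// mulr_gt0// addr_gt0.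
rewrite expr_div_n !sqr_sqrtr; last 2 first.
- by rewrite !mulr_ge0 ?addr_ge0// ltW.
- by rewrite divr_ge0 ?mulr_ge0 ?addr_ge0// ltW.
by apply/eqP; field; apply/andP; split; apply/eqP; lra.
Qed.

(** The denominator of [theta]. It is also the numerator of both slopes of the hat, so it cancels in
    [theta] times the hat and no square root survives. *)
Definition schauder_norm {R : realType} (t1 t2 t3 : R) : R :=
  Num.sqrt ((t2 - t1) * (t3 - t2) * (t3 - t1)).

Lemma schauder_norm_gt0 {R : realType} (t1 t2 t3 : R) : t1 < t2 -> t2 < t3 ->
  0 < schauder_norm t1 t2 t3.
Proof.
by move=> t12 t23; rewrite sqrtr_gt0 !mulr_gt0 ?subr_gt0// (lt_trans t12).
Qed.

Lemma schauder_normE {R : realType} (t1 t2 t3 t : R) :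
  0 <= t1 -> t1 < t2 -> t2 < t3 -> 0 <= t ->
  schauder (t1, t2, t3) t =
  schauder_norm t1 t2 t3 / ((t2 - t1) * (t3 - t1)) *
    (Num.min (Num.max t t1) t2 - t1)
  - schauder_norm t1 t2 t3 / ((t3 - t2) * (t3 - t1)) *
    (Num.min (Num.max t t2) t3 - t2).
Proof.
move=> t10 t12 t23 t0; rewrite schauder_clampE// /schauder_norm.
have -> : t3 - t1 = (t2 - t1) + (t3 - t2) by ring.
rewrite sqrt_ratioE ?subr_gt0// [t2 - t1 + (t3 - t2)]addrC.
by rewrite sqrt_ratioE ?subr_gt0// [(t3 - t2) * (t2 - t1)]mulrC.
Qed.

Lemma schauder_rise {R : realType} (t1 t2 t3 t : R) :
  0 <= t1 -> t1 < t2 -> t2 < t3 -> t1 <= t <= t2 ->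
  schauder (t1, t2, t3) t =
  schauder_norm t1 t2 t3 / ((t2 - t1) * (t3 - t1)) * (t - t1).
Proof.
move=> t10 t12 t23 /andP[t1t tt2]; rewrite schauder_normE ?(le_trans t10)//.
rewrite (max_l t1t) (min_l tt2) (max_r tt2) (min_l (ltW t23)).
by rewrite subrr mulr0 subr0.
Qed.

Lemma schauder_fall {R : realType} (t1 t2 t3 t : R) :
  0 <= t1 -> t1 < t2 -> t2 < t3 -> t2 <= t <= t3 ->
  schauder (t1, t2, t3) t =
  schauder_norm t1 t2 t3 / ((t3 - t2) * (t3 - t1)) * (t3 - t).
Proof.
move=> t10 t12 t23 /andP[t2t tt3]; have t1t : t1 <= t by lra.
rewrite schauder_normE ?(le_trans t10)//.
rewrite (max_l t2t) (min_l tt3) (max_l t1t) (min_r t2t).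
by field; apply/and3P; split; apply/eqP; lra.
Qed.

(** Left of [t1] nothing has been integrated yet; right of [t3] the positive and negative areas of
    the Haar function cancel, each being [schauder_norm t1 t2 t3 / (t3 - t1)]. *)
Lemma schauder_out {R : realType} (t1 t2 t3 t : R) :
  0 <= t1 -> t1 < t2 -> t2 < t3 -> 0 <= t -> (t <= t1) || (t3 <= t) ->
  schauder (t1, t2, t3) t = 0.
Proof.
move=> t10 t12 t23 t0 /orP[tt1|t3t]; rewrite schauder_normE//.
  have tt2 : t <= t2 by lra.
  rewrite (max_r tt1) (min_l (ltW t12)) (max_r tt2) (min_l (ltW t23)).
  by rewrite !subrr !mulr0 subrr.
have t1t : t1 <= t by lra.
have t2t : t2 <= t by lra.
rewrite (max_l t1t) (min_r t2t) (max_l t2t) (min_r t3t).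
by field; apply/and3P; split; apply/eqP; lra.
Qed.

(** Supplies the nonzero diagonal of the triangular system for the coefficients. *)
Lemma schauder_peak_gt0 {R : realType} (t1 t2 t3 : R) :
  0 <= t1 -> t1 < t2 -> t2 < t3 -> 0 < schauder (t1, t2, t3) t2.
Proof.
move=> t10 t12 t23; rewrite schauder_rise ?lexx ?andbT ?(ltW t12)//.
have := schauder_norm_gt0 _ _ _ t12 t23.
have ? := lt_trans t12 t23.
by move=> ?; rewrite mulr_gt0 ?divr_gt0 ?mulr_gt0 ?subr_gt0.
Qed.

(** Heine's theorem, from compactness in near-covering form: a property that holds for [d] near
    [0^'+] locally around each point of the segment holds for one [d] on the whole segment. *)
Lemma unif_continuous_itv {R : realType} (x : R -> R) (a b eps : R) :
  {within `[a, b], continuous x} -> 0 < eps ->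
  exists2 d : R, 0 < d & forall s t, a <= s <= b -> a <= t <= b ->
    `|s - t| < d -> `|x s - x t| < eps.
Proof.
move=> /subspace_continuousP cx e0.
have /compact_near_coveringP/near_covering_withinP := @segment_compact R a b.
move=> /(_ R (0^'+) (fun d s => forall t, a <= t <= b -> `|s - t| < d ->
  `|x s - x t| < eps)) /(_ _) H.
have {}H : \forall d \near 0^'+, `[a, b] `<=`
    (fun s => forall t, a <= t <= b -> `|s - t| < d -> `|x s - x t| < eps).
  apply: H => c cab; have /cvgrPdist_lt /(_ (eps / 2)) := cx c cab.
  rewrite divr_gt0// => /(_ isT).
  rewrite near_withinE => /nbhs_ballP[d /= d0 cd].
  (* Halving the radius keeps both [s] and [t] within [d] of [c], so each value is within [eps / 2]
     of [x c]. *)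
  exists (ball c (d / 2), [set e | e < d / 2]).
    split; first by apply: nbhsx_ballx; lra.
    by apply: nbhs_right_lt; lra.
  move=> [s e] /= [cs ed] sab t tab st.
  rewrite /ball/= in cd cs.
  have /cd/(_ sab) xs : `|c - s| < d by lra.
  have ct : `|c - t| < d.
    rewrite (_ : c - t = (c - s) + (s - t)); last by ring.
    by rewrite (le_lt_trans (ler_normD _ _))//; lra.
  have {ct}xt := cd _ ct tab.
  rewrite (_ : x s - x t = (x c - x t) - (x c - x s)); last by ring.
  by rewrite (le_lt_trans (ler_normB _ _))//; lra.
near (0 : R)^'+ => d.
have Hd : `[a, b] `<=` (fun s => forall t, a <= t <= b -> `|s - t| < d ->
  `|x s - x t| < eps) by near: d.
by exists d => // s t sab; apply: Hd => /=; rewrite in_itv.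
Unshelve. all: by end_near.
Qed.

(** * Chords and fans of hats *)

Definition chord {R : realType} (x : R -> R) (u v t : R) : R :=
  x u + (x v - x u) * ((t - u) / (v - u)).

(** [theta] as a function of a triple instead of a level and an index, so that sums can run over
    lists of triples. *)
Definition hat_coef {R : realType} (x : R -> R) (tr : R * R * R) : R :=
  let: (t1, t2, t3) := tr in
  ((x t2 - x t1) * (t3 - t2) - (x t3 - x t2) * (t2 - t1)) /
  Num.sqrt ((t2 - t1) * (t3 - t2) * (t3 - t1)).

(** Both sides are affine on [[t1, t2]] and equal [x t1] at [t1], where the hat vanishes; the
    coefficient is the one that lifts the long chord to [x t2] at the peak. *)
Lemma chord_add_hat_left {R : realType} (x : R -> R) (t1 t2 t3 t : R) :
  0 <= t1 -> t1 < t2 -> t2 < t3 -> t1 <= t <= t2 ->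
  chord x t1 t3 t + hat_coef x (t1, t2, t3) * schauder (t1, t2, t3) t =
  chord x t1 t2 t.
Proof.
move=> t10 t12 t23 tin; rewrite schauder_rise// /chord /hat_coef.
rewrite -/(schauder_norm t1 t2 t3).
have := schauder_norm_gt0 _ _ _ t12 t23.
set w := schauder_norm _ _ _ => w0.
by field; rewrite ?gt_eqF ?subr_gt0// (lt_trans t12).
Qed.

Lemma chord_add_hat_right {R : realType} (x : R -> R) (t1 t2 t3 t : R) :
  0 <= t1 -> t1 < t2 -> t2 < t3 -> t2 <= t <= t3 ->
  chord x t1 t3 t + hat_coef x (t1, t2, t3) * schauder (t1, t2, t3) t =
  chord x t2 t3 t.
Proof.
move=> t10 t12 t23 tin; rewrite schauder_fall// /chord /hat_coef.
rewrite -/(schauder_norm t1 t2 t3).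
have := schauder_norm_gt0 _ _ _ t12 t23.
set w := schauder_norm _ _ _ => w0.
by field; rewrite ?gt_eqF ?subr_gt0// (lt_trans t12).
Qed.

(** Adjacency is expressed by membership and order, without indices, so that it passes easily to
    lists with points filtered out or removed. *)
Definition consecutive {R : realType} (s : seq R) (u v : R) : Prop :=
  [/\ u \in s, v \in s, u < v & {in s, forall w, (w <= u) || (v <= w)}].

(** The hats of one coarse interval: all share the left end [a]. The recursive form allows induction
    on [s]. *)
Definition fan {R : realType} (a v : R) (s : seq R) : seq (R * R * R) :=
  pairmap (fun v w => (a, v, w)) v s.

Lemma mem_fan {R : realType} (a v : R) (s : seq R) (tr : R * R * R) :
  path <%R v s -> tr \in fan a v s ->
  [/\ tr.1.1 = a, v <= tr.1.2, tr.1.2 < tr.2, tr.2 <= last v s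
    & consecutive (v :: s) tr.1.2 tr.2].
Proof.
elim: s v => [//|w s IH] v /= /andP[vw ws].
have sw y : y \in s -> w < y.
  by move=> ys; have /allP/(_ y ys) := order_path_min lt_trans ws.
have wlast : w <= last w s.
  by have := mem_last w s; rewrite inE => /predU1P[->|/sw/ltW].
rewrite inE => /predU1P[->/=|/(IH _ ws)[-> wtr tr23 ->]].
  split=> //; split=> //; rewrite ?inE ?eqxx ?orbT// => y.
  rewrite !inE => /or3P[/eqP->|/eqP->|/sw/ltW ->]; rewrite ?lexx ?orbT//.
case=> tr2 tr3 _ trs; split=> //; first by rewrite (le_trans (ltW vw)).
split=> //; rewrite ?[_ \in v :: _]inE ?tr2 ?tr3 ?orbT// => y.
by rewrite inE => /predU1P[->|/trs//]; rewrite (le_trans (ltW vw)).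
Qed.

Lemma pairwise_fan {R : realType} (a v : R) (s : seq R) : path <%R v s ->
  pairwise (fun tr tr' : R * R * R => tr.2 <= tr'.1.2) (fan a v s).
Proof.
elim: s v => [//|w s IH] v /= /andP[vw ws].
rewrite IH// andbT; apply/allP => tr /mem_fan -/(_ ws)[_ + _ _ _]; exact.
Qed.

(** Induction on [s], inserting points from right to left: the hats after the first interpolate [x]
    on the points other than [v], and the first hat then splits the chord from [a] to the successor
    of [v] at [v]. *)
Lemma chord_add_fan {R : realType} (x : R -> R) (a v : R) (s : seq R)
    (u w t : R) : 0 <= a -> path <%R a (v :: s) ->
  consecutive (a :: v :: s) u w -> u <= t <= w ->
  chord x a (last v s) t
    + \sum_(tr <- fan a v s) hat_coef x tr * schauder tr t
  = chord x u w t.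
Proof.
move=> a0; elim: s v u w => [|v' s IH] v u w /=.
  rewrite big_nil addr0 andbT => av [].
  rewrite !inE => /orP[]/eqP-> /orP[]/eqP->//; try lra.
move=> /and3P[av vv' v's] [uin win uw uws] /andP[ut tw].
have av' : a < v' by apply: lt_trans vv'.
have v's' y : y \in s -> v' < y.
  by move=> ys; have /allP/(_ y ys) := order_path_min lt_trans v's.
have pa : path <%R a (v' :: s) by rewrite /= av'.
rewrite big_cons addrCA addrC.
have uwv : {in a :: v' :: s, forall y, (y <= u) || (w <= y)}.
  move=> y; rewrite inE => /predU1P[->|ys]; apply: uws; first exact: mem_head.
  by move: ys; rewrite !inE => ->; rewrite !orbT.
(* Either [[u, w]] is [[a, v]] or [[v, v']], both handled by the induction hypothesis on [[a, v']],
   or it lies beyond [v'], where the first hat vanishes. *)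
have [uv|vu] := leP w v.
  have ua : u = a.
    have := uin; rewrite !inE => /or4P[/eqP//|/eqP||/v's']; lra.
  have wv : w = v.
    have := win; rewrite !inE => /or4P[/eqP|/eqP//|/eqP|/v's']; lra.
  subst u w.
  rewrite (IH v' a v'); last 3 first.
  - exact: pa.
  - split; rewrite ?inE ?eqxx ?orbT// => y.
    by rewrite !inE => /or3P[/eqP->|/eqP->|/v's'/ltW->]; rewrite ?lexx ?orbT.
  - by rewrite ut (le_trans tw)// ltW.
  by rewrite chord_add_hat_left// ut.
have vu' : v <= u.
  have := uws v; rewrite !inE eqxx orbT => /(_ isT).
  by rewrite [w <= v]leNgt vu orbF.
have [wv'|v'w] := leP w v'.
  have uv : u = v.
    have := uin; rewrite !inE => /or4P[/eqP|/eqP//|/eqP|/v's']; lra.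
  have wv : w = v'.
    have := win; rewrite !inE => /or4P[/eqP|/eqP|/eqP//|/v's']; lra.
  subst u w.
  rewrite (IH v' a v'); last 3 first.
  - exact: pa.
  - split; rewrite ?inE ?eqxx ?orbT// => y.
    by rewrite !inE => /or3P[/eqP->|/eqP->|/v's'/ltW->]; rewrite ?lexx ?orbT.
  - by rewrite tw andbT (le_trans (ltW av)).
  by rewrite chord_add_hat_right// ut.
have v'u : v' <= u.
  have := uws v'; rewrite !inE eqxx !orbT => /(_ isT).
  by rewrite [w <= v']leNgt v'w orbF.
rewrite (IH v' u w)//; first last.
- by rewrite ut.
- split=> //.
    have := uin; rewrite !inE => /or4P[|/eqP uE||]; try by move=> ->; rewrite ?orbT.
    lra.
  have := win; rewrite !inE => /or4P[|/eqP uE||]; try by move=> ->; rewrite ?orbT.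
  lra.
rewrite schauder_out//; first by rewrite mulr0 addr0.
  lra.
by rewrite (le_trans v'u ut) orbT.
Qed.

(** * Points of a sorted sequence in an interval *)

Lemma sorted_head_le {R : realType} (p : seq R) (y : R) :
  sorted <%R p -> y \in p -> head 0 p <= y.
Proof.
case: p => //= a s ps; rewrite inE => /predU1P[->//|ys].
by have /allP/(_ y ys)/ltW := order_path_min lt_trans ps.
Qed.

Lemma sorted_le_last {R : realType} (p : seq R) (y : R) :
  sorted <%R p -> y \in p -> y <= last 0 p.
Proof.
elim: p y => //= a [|b s] IH y /=; first by rewrite inE => _ /eqP->.
move=> /andP[ab ps]; rewrite inE => /predU1P[->|]; last exact: IH.
by apply: (le_trans (ltW ab)); apply: IH; rewrite ?mem_head.
Qed.

Lemma points_in_cons {R : realType} (q : seq R) (a b : R) :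
  sorted <%R q -> a \in q -> b \in q -> a < b ->
  exists v s, [/\ points_in q a b = a :: v :: s, path <%R a (v :: s)
    & last v s = b].
Proof.
move=> sq aq bq ab.
have sp : sorted <%R (points_in q a b) by apply: sorted_filter; first exact: lt_trans.
have ap : a \in points_in q a b by rewrite mem_filter lexx ltW.
have bp : b \in points_in q a b by rewrite mem_filter lexx ltW.
have := sorted_head_le _ _ sp ap; have := sorted_le_last _ _ sp bp.
have pP y : y \in points_in q a b -> a <= y <= b by rewrite mem_filter => /andP[].
case: (points_in q a b) sp ap bp pP => [//|c [|v s]] sp.
  by rewrite !inE => /eqP E /eqP F; move: ab; rewrite E F ltxx.
move=> _ _ pP /= bl ca.
have ac : c = a by apply/eqP; rewrite eq_le ca; have /andP[] := pP c (mem_head _ _).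
subst c; exists v, s; split=> //; apply/eqP; rewrite eq_le bl andbT.
by have /andP[] := pP (last a (v :: s)) (mem_last _ _).
Qed.

(** Bridge from the indexed to the recursive description: entry [i] of either list uses the points
    numbered [i.+1] and [i.+2]. *)
Lemma interval_triplesE {R : realType} (q : seq R) (a b v : R) (s : seq R) :
  points_in q a b = a :: v :: s -> interval_triples q a b = fan a v s.
Proof.
move=> E; rewrite /interval_triples E /=.
apply: (@eq_from_nth _ (0, 0, 0)); first by rewrite size_map size_iota size_pairmap.
move=> i; rewrite size_map size_iota => si.
by rewrite (nth_map 0%N) ?size_iota// nth_iota//= (nth_pairmap 0).
Qed.

(** * Refinement of a partition *)

Section Partition.
Context {R : realType} {p : seq R}.
Hypothesis part : is_partition p.

Lemma partition_sorted : sorted <%R p. Proof. by case: part. Qed.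

Lemma partition0 : nth 0 p 0 = 0. Proof. by rewrite nth0; case: part. Qed.

Lemma partition1 : nth 0 p (nintervals p) = 1.
Proof. by rewrite /nintervals nth_last; case: part. Qed.

Lemma size_partition : size p = (nintervals p).+1.
Proof. by rewrite /nintervals prednK//; case: part => _ /ltnW. Qed.

Lemma mem_partition i : (i <= nintervals p)%N -> nth 0 p i \in p.
Proof. by move=> ip; rewrite mem_nth// size_partition. Qed.

Lemma partition_lt i j : (i < j <= nintervals p)%N -> nth 0 p i < nth 0 p j.
Proof.
move=> /andP[ij jp]; rewrite lt_sorted_ltn_nth ?partition_sorted// inE.
  by rewrite size_partition ltnS (leq_trans (ltnW ij)).
by rewrite size_partition.
Qed.

Lemma partition_le i j : (i <= j <= nintervals p)%N -> nth 0 p i <= nth 0 p j.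
Proof.
by case: (ltngtP i j) => //= [ij jp|->//]; rewrite ltW// partition_lt// ij.
Qed.

Lemma partition_itv y : y \in p -> 0 <= y <= 1.
Proof.
case: part => sp _ h l yp.
by rewrite -{1}h -l sorted_head_le ?sorted_le_last.
Qed.

Lemma partition_consecutive i : (i < nintervals p)%N ->
  consecutive p (nth 0 p i) (nth 0 p i.+1).
Proof.
move=> ip; split; rewrite ?mem_partition//; first exact: ltnW.
  by rewrite partition_lt// leqnn.
move=> y /(nthP 0)[j]; rewrite size_partition ltnS => jp <-.
apply/orP; case: (leqP j i) => ij; [left|right]; apply: partition_le.
  by rewrite ij ltnW.
by rewrite ij.
Qed.

Lemma consecutive_partition u v : consecutive p u v ->
  exists2 i, (i < nintervals p)%N & u = nth 0 p i /\ v = nth 0 p i.+1.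
Proof.
move=> [/(nthP 0)[i + <-] /(nthP 0)[j + <-]].
rewrite !size_partition !ltnS => ip jp ij uv.
have {}ij : (i < j)%N.
  by rewrite ltnNge; apply: contraL ij => ji; rewrite -leNgt partition_le// ji.
have iS : (i.+1 <= nintervals p)%N by apply: leq_trans jp.
exists i => //; split=> //; apply/eqP; rewrite eq_le.
have /orP[|->] := uv _ (mem_partition _ iS).
  by rewrite leNgt partition_lt// leqnn.
by rewrite partition_le// ij.
Qed.

Lemma consecutive_le_mesh u v : consecutive p u v -> v - u <= mesh p.
Proof.
move=> /consecutive_partition[i ip [-> ->]].
pose d (i : 'I_(nintervals p)) := nth 0 p i.+1 - nth 0 p i.
exact: (le_bigmax 0 d (Ordinal ip)).
Qed.

Lemma partition_locate_co t : 0 <= t < 1 ->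
  exists2 i, (i < nintervals p)%N & nth 0 p i <= t < nth 0 p i.+1.
Proof.
move=> /andP[t0 t1].
have ex : exists i, t < nth 0 p i by exists (nintervals p); rewrite partition1.
(* The first point beyond [t] is the right end sought: minimality bounds its index and puts the
   preceding point at or before [t]. *)
case: (ex_minnP ex) => -[|i]; first by rewrite partition0 ltNge t0.
move=> ti min; exists i.
  by apply: min; rewrite partition1.
by rewrite ti andbT leNgt; apply/negP => /min; rewrite ltnn.
Qed.

Lemma partition_locate t : 0 <= t <= 1 ->
  exists2 i, (i < nintervals p)%N & nth 0 p i <= t <= nth 0 p i.+1.
Proof.
move=> /andP[t0]; rewrite le_eqVlt => /predU1P[->|t1].
  have p0 : (0 < nintervals p)%N by rewrite -ltnS -size_partition; case: part.
  exists (nintervals p).-1; rewrite ?prednK// partition1 lexx andbT.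
  by rewrite -partition1 partition_le// leq_pred leqnn.
have [|i ip /andP[h1 h2]] := partition_locate_co t; first by rewrite t0.
by exists i => //; rewrite h1 ltW.
Qed.

End Partition.

(** [level_triples P m] is this list for [P m] and [P m.+1], so a single level can be studied with
    just two partitions. *)
Definition refinement_triples {R : realType} (p q : seq R) : seq (R * R * R) :=
  flatten [seq interval_triples q (nth 0 p i) (nth 0 p i.+1)
          | i <- iota 0 (nintervals p)].

Section Refinement.
Context {R : realType} {p q : seq R}.
Hypotheses (partp : is_partition p) (partq : is_partition q)
  (pq : {subset p <= q}).

(** Take the half-open coarse interval containing [u]. Its right end is a point of [q] beyond [u],
    hence not before [w]. *)
Lemma consecutive_refinement u w : consecutive q u w ->
  exists2 i, (i < nintervals p)%N & nth 0 p i <= u /\ w <= nth 0 p i.+1.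
Proof.
move=> [uq wq uw cuw].
have /andP[u0 _] := partition_itv partq _ uq.
have /andP[_ w1] := partition_itv partq _ wq.
have [|i ip /andP[iu ui]] := partition_locate_co partp u.
  by rewrite u0 (lt_le_trans uw).
exists i => //; split=> //.
have /orP[|//] := cuw _ (pq _ (mem_partition partp _ ip)).
by rewrite leNgt ui.
Qed.

Lemma refinement_interval i : (i < nintervals p)%N ->
  exists v s, [/\ points_in q (nth 0 p i) (nth 0 p i.+1) = nth 0 p i :: v :: s,
    path <%R (nth 0 p i) (v :: s), last v s = nth 0 p i.+1
  & interval_triples q (nth 0 p i) (nth 0 p i.+1) = fan (nth 0 p i) v s].
Proof.
move=> ip.
have [//|||v [s [E ps ls]]] := points_in_cons q (nth 0 p i) (nth 0 p i.+1)
    (partition_sorted partq).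
- by rewrite pq// mem_partition// ltnW.
- by rewrite pq// mem_partition.
- by rewrite partition_lt// leqnn.
by exists v, s; split=> //; exact: interval_triplesE.
Qed.

Lemma mem_interval_triples i tr : (i < nintervals p)%N ->
  tr \in interval_triples q (nth 0 p i) (nth 0 p i.+1) ->
  [/\ tr.1.1 = nth 0 p i, tr.1.1 < tr.1.2, tr.1.2 < tr.2,
      tr.2 <= nth 0 p i.+1 & tr.1.2 \in q].
Proof.
move=> ip; have [v [s [E /= /andP[av vs] ls ->]]] := refinement_interval _ ip.
move=> /(mem_fan _ _ _ _ vs)[-> vtr tr23 trl [trin _ _ _]].
rewrite -ls; split=> //; first exact: lt_le_trans vtr.
have : tr.1.2 \in points_in q (nth 0 p i) (nth 0 p i.+1).
  by rewrite E inE trin orbT.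
by rewrite mem_filter => /andP[].
Qed.

Lemma mem_refinement_triples tr : tr \in refinement_triples p q ->
  exists2 i, (i < nintervals p)%N &
    tr \in interval_triples q (nth 0 p i) (nth 0 p i.+1).
Proof.
by move=> /flatten_mapP[i]; rewrite mem_iota add0n => /= ip tri; exists i.
Qed.

Lemma refinement_triples_wf tr : tr \in refinement_triples p q ->
  [/\ 0 <= tr.1.1, tr.1.1 < tr.1.2, tr.1.2 < tr.2 & tr.1.2 \in q].
Proof.
move=> /mem_refinement_triples[i ip /(mem_interval_triples _ _ ip)[tri *]].
split=> //; rewrite tri.
by have /andP[] := partition_itv partp _ (mem_partition partp _ (ltnW ip)).
Qed.

Lemma schauder_interval_out i tr t : (i < nintervals p)%N ->
  tr \in interval_triples q (nth 0 p i) (nth 0 p i.+1) -> 0 <= t ->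
  (t <= nth 0 p i) || (nth 0 p i.+1 <= t) -> schauder tr t = 0.
Proof.
move=> ip /(mem_interval_triples _ _ ip).
have /andP[i0 _] := partition_itv partp _ (mem_partition partp _ (ltnW ip)).
case: tr => -[t1 t2] t3 /= [E t12 t23 t3i _] t0 tout.
rewrite schauder_out// ?E//.
by case/orP: tout => [->//|/(le_trans t3i) ->]; rewrite orbT.
Qed.

(** Each hat is supported in one interval of [p], which has no point of [p] in its interior. *)
Lemma schauder_coarse_eq0 tr t :
  tr \in refinement_triples p q -> t \in p -> schauder tr t = 0.
Proof.
move=> /mem_refinement_triples[i ip tri] tp.
apply: (schauder_interval_out i) => //.
  by have /andP[] := partition_itv partp _ tp.
by have [_ _ _ /(_ _ tp)] := partition_consecutive partp _ ip.
Qed.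

(** Hats in the other coarse intervals vanish at [t]; those in interval [i] form a fan, to which
    [chord_add_fan] applies. *)
Lemma chord_add_level (x : R -> R) i u w t : (i < nintervals p)%N ->
  consecutive q u w -> nth 0 p i <= u -> w <= nth 0 p i.+1 -> u <= t <= w ->
  chord x (nth 0 p i) (nth 0 p i.+1) t
    + \sum_(tr <- refinement_triples p q) hat_coef x tr * schauder tr t
  = chord x u w t.
Proof.
move=> ip cuw iu wi /andP[ut tw].
have it : nth 0 p i <= t by apply: le_trans ut.
have ti : t <= nth 0 p i.+1 by apply: le_trans wi.
have /andP[i0 _] := partition_itv partp _ (mem_partition partp _ (ltnW ip)).
rewrite big_flatten big_map /= (bigD1_seq i) ?iota_uniq ?mem_iota ?add0n//=.
rewrite [X in _ + (_ + X)]big1_seq ?addr0; last first.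
  move=> j; rewrite mem_iota add0n /= => /andP[ji jp].
  rewrite big_seq big1// => tr /(schauder_interval_out j) ->; rewrite ?mulr0//.
    by rewrite (le_trans i0).
  case: (ltngtP i j) ji => // ij _.
    by rewrite (le_trans ti)// partition_le// ij ltnW.
  by rewrite orbC (le_trans _ it)// partition_le// ij ltnW.
have [v [s [E ps ls ->]]] := refinement_interval _ ip.
rewrite -ls (chord_add_fan _ _ _ _ u w) ?ut//.
rewrite -E; case: cuw => uq wq uw cuw; split=> //.
- by rewrite mem_filter uq iu (le_trans (ltW uw)).
- by rewrite mem_filter wq wi (le_trans iu (ltW uw)).
- by move=> y; rewrite mem_filter => /andP[_ /cuw].
Qed.

(** There is one hat fewer than points of [q] after the left end and up to the right end. Counting
    points from the start of [q] makes the sum over [i] telescope, and the additive form avoids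
    truncated subtraction. *)
Lemma size_interval_triples i : (i < nintervals p)%N ->
  (size (interval_triples q (nth 0 p i)%R (nth 0 p i.+1)%R)
   + (count (fun y => y <= nth 0 p i)%R q).+1
   = count (fun y => y <= nth 0 p i.+1)%R q)%N.
Proof.
move=> ip; have [v [s [E ps ls ->]]] := refinement_interval _ ip.
have ab : nth 0 p i < nth 0 p i.+1 by rewrite partition_lt// leqnn.
have aq : nth 0 p i \in q by rewrite pq// mem_partition// ltnW.
move: (nth 0 p i) (nth 0 p i.+1) E ab aq => a b E ab aq {ps ls}.
have : size (points_in q a b) = (size s).+2 by rewrite E.
rewrite size_filter size_pairmap.
have uq : uniq q := lt_sorted_uniq (partition_sorted partq).
(* As [q] has no repetition, [a] itself accounts for exactly one point. *)
have -> : count (fun y => y <= a) q = (count (fun y => (y < a)%R) q).+1.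
  have := count_uniq_mem a uq; rewrite aq.
  have := count_predUI (pred1 a) (fun y => (y < a)%R) q.
  rewrite [count (predI _ _) _](@eq_count _ _ pred0) ?count_pred0 => [|y /=]; last first.
    by case: eqP => // ->; rewrite ltxx.
  rewrite (@eq_count _ (predU _ _) (fun y => y <= a)) => [|y /=]; last first.
    by rewrite le_eqVlt.
  by rewrite addn0 => -> ->.
have := count_predUI (fun y => (a <= y) && (y <= b)) (fun y => (y < a)%R) q.
rewrite [count (predI _ _) _](@eq_count _ _ pred0) ?count_pred0 => [|y /=]; last first.
  by case: leP; rewrite ?andbF.
rewrite (@eq_count _ (predU _ _) (fun y => y <= b)) => [|y /=]; last first.
  by case: leP => /= [_|ya]; rewrite ?orbF// ltW// (lt_trans ya).
by rewrite addn0 => -> ->; rewrite !addSn !addnS.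
Qed.

Lemma size_refinement_triples :
  size (refinement_triples p q) = (nintervals q - nintervals p)%N.
Proof.
rewrite size_flatten /shape sumnE !big_map.
rewrite -[X in iota 0 X]subn0 -/(index_iota _ _).
(* The summand [k] stands for the one point per coarse interval that yields no hat. At
   [k = nintervals p] the two counts are [1] and [size q]. *)
suff H k : (k <= nintervals p)%N ->
    (\sum_(0 <= i < k)
       size (interval_triples q (nth 0 p i)%R (nth 0 p i.+1)%R) + k
     + count (fun y => y <= nth 0 p 0)%R q
     = count (fun y => y <= nth 0 p k)%R q)%N.
  have := H _ (leqnn _); rewrite (partition0 partp) (partition1 partp).
  have -> : count (fun y => y <= 1) q = size q.
    apply/eqP; rewrite -all_count; apply/allP => y yq.
    by have /andP[] := partition_itv partq _ yq.
  have -> : count (fun y => y <= 0) q = 1%N.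
    have uq : uniq q := lt_sorted_uniq (partition_sorted partq).
    have q0 : 0 \in q by rewrite -(partition0 partp) pq ?mem_partition.
    have := count_uniq_mem 0 uq; rewrite q0 => /= <-.
    apply: eq_in_count => y yq /=.
    by have /andP[y0 _] := partition_itv partq _ yq; rewrite eq_le y0 andbT.
  rewrite (size_partition partq); lia.
elim: k => [|k IH] kp; first by rewrite big_geq.
rewrite big_nat_recr//= -size_interval_triples// -IH ?(ltnW kp)//.
by rewrite !addnS !addSn -!addnA addnCA !addnA.
Qed.

Lemma pairwise_refinement_triples :
  pairwise (fun tr tr' : R * R * R => tr.2 <= tr'.1.2) (refinement_triples p q).
Proof.
(* The start of [iota] is generalised because the induction removes the leftmost coarse interval. *)
suff H j n : (j + n <= nintervals p)%N ->
    pairwise (fun tr tr' : R * R * R => tr.2 <= tr'.1.2)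
      (flatten [seq interval_triples q (nth 0 p i) (nth 0 p i.+1)
               | i <- iota j n]) by exact: H.
elim: n j => [//|n IH] j jn /=.
have jp : (j < nintervals p)%N by lia.
rewrite pairwise_cat IH ?andbT; last by lia.
apply/andP; split; last first.
  have [v [s [_ /= /andP[_ ps] _ ->]]] := refinement_interval _ jp.
  exact: pairwise_fan.
apply/allrelP => tr tr' /(mem_interval_triples _ _ jp)[_ _ _ trj _].
move=> /flatten_mapP[k]; rewrite mem_iota => /andP[jk kn].
have kp : (k < nintervals p)%N by lia.
move=> /(mem_interval_triples _ _ kp)[trk k12 _ _ _].
rewrite (le_trans trj)// (le_trans _ (ltW k12))// trk partition_le//.
by rewrite jk ltnW.
Qed.

(* The maximum of each hat lies beyond the supports of all earlier hats, so
   evaluation at the maxima gives a triangular system. *)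
Lemma schauder_level_free (d : nat -> R) :
  (forall t, t \in q ->
    \sum_(k < (nintervals q - nintervals p)%N)
      d k * schauder (nth (0, 0, 0) (refinement_triples p q) k) t = 0) ->
  forall k, (k < nintervals q - nintervals p)%N -> d k = 0.
Proof.
rewrite -size_refinement_triples; set L := refinement_triples p q => d0 k.
(* Downward induction on [k]: at the peak of hat [k] the earlier hats vanish and the later
   coefficients are already known to be zero. *)
move En : (size L - k)%N => n; elim/ltn_ind: n k En => n IH k En kL.
have wf l : (l < size L)%N -> _ :=
  fun lL => refinement_triples_wf _ (mem_nth (0, 0, 0) lL).
have [k0 k12 k23 kq] := wf k kL.
have := d0 _ kq; rewrite (bigD1 (Ordinal kL))//= big1 ?addr0 => [|l /eqP lk].
  move=> /eqP; rewrite mulf_eq0 => /orP[/eqP//|].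
  case: (nth _ L k) k0 k12 k23 {kq} => -[t1 t2] t3 /= k0 k12 k23.
  by rewrite gt_eqF// schauder_peak_gt0.
have [kl|lk'|E] := ltngtP k l.
- by rewrite (IH (size L - l)%N)// ?mul0r//; have := ltn_ord l; lia.
- have [l0 l12 l23 lq] := wf l (ltn_ord l).
  have := pairwiseP (0, 0, 0) pairwise_refinement_triples.
  move=> /(_ l k (ltn_ord l) kL lk').
  case: (nth _ L l) l0 l12 l23 {lq} => -[t1 t2] t3 /= l0 l12 l23 t3k.
  by rewrite schauder_out ?mulr0 ?t3k ?orbT//; lra.
- by case: lk; apply/val_inj.
Qed.

End Refinement.

(** * The Schauder series *)

(** The chord value is a convex combination of [x u] and [x v], and balls are convex. *)
Lemma chord_dist_lt {R : realType} (x : R -> R) (u v t e : R) :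
  u < v -> u <= t <= v -> `|x t - x u| < e -> `|x t - x v| < e ->
  `|x t - chord x u v t| < e.
Proof.
move=> uv /andP[ut tv]; rewrite !ltr_norml /chord.
have l0 : 0 <= (t - u) / (v - u) by rewrite divr_ge0 ?subr_ge0// ltW.
have l1 : (t - u) / (v - u) <= 1 by rewrite ler_pdivrMr ?subr_gt0//; lra.
move: (x t) (x u) (x v) (_ / _) l0 l1 => a b c l l0 l1 /andP[h1 h2] /andP[h3 h4].
have [bc|cb] := leP b c; apply/andP; split; nra.
Qed.

Section Series.
Context {R : realType} {P : nat -> seq R}.
Hypothesis refP : finitely_refining P.

Lemma refining_partition n : is_partition (P n). Proof. by case: refP. Qed.

Lemma refining_sub n m : (n <= m)%N -> {subset P n <= P m}.
Proof.
have [_ _ subP _ _] := refP.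
elim: m => [|m IH]; first by rewrite leqn0 => /eqP->.
by rewrite leq_eqVlt => /predU1P[->//|/IH + y yn]; move=> /(_ y yn)/subP.
Qed.

Let step m : {subset P m <= P m.+1}. Proof. exact: refining_sub. Qed.

Lemma schauder_partial_recr (x : R -> R) (c : nat -> nat -> R) N t :
  schauder_partial P x c N.+1 t = schauder_partial P x c N t
    + \sum_(k < (nintervals (P N.+1) - nintervals (P N))%N)
        c N k * schauder_fun P N k t.
Proof. by rewrite /schauder_partial big_ord_recr/= addrA. Qed.

(** The affine term is the chord on [P 0], and the hats of level [N] turn the interpolation on [P N]
    into the one on [P N.+1]. *)
Lemma schauder_partial_theta (x : R -> R) N u v t :
  consecutive (P N) u v -> u <= t <= v ->
  schauder_partial P x (theta P x) N t = chord x u v t.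
Proof.
elim: N u v => [|N IH] u v cuv /andP[ut tv].
  have [P0 _ _ _ _] := refP.
  have [i] := consecutive_partition (refining_partition 0) _ _ cuv.
  rewrite P0 ltnS leqn0 => /eqP-> [-> ->] /=.
  by rewrite /schauder_partial big_ord0 /chord !subr0 divr1 addr0.
have [i ip [iu vi]] := consecutive_refinement
  (refining_partition N) (refining_partition N.+1) (step N) _ _ cuv.
rewrite schauder_partial_recr (IH (nth 0 (P N) i) (nth 0 (P N) i.+1)); last first.
- by rewrite (le_trans iu ut) (le_trans tv vi).
- exact: partition_consecutive (refining_partition N) _ ip.
have sz := size_refinement_triples (refining_partition N)
  (refining_partition N.+1) (step N).
rewrite -(chord_add_level (refining_partition N) (refining_partition N.+1)
  (step N) x i u v t)// ?ut//; congr (_ + _).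
(* Once the list sum is indexed, the summands agree by conversion, since [theta] unfolds to
   [hat_coef] at [triple P N k]. *)
by rewrite (big_nth (0, 0, 0)) big_mkord sz.
Qed.

(** At a point of [P n] the series is a finite sum, all hats of level at least [n] being zero
    there. *)
Lemma schauder_partial_stationary (x : R -> R) (c : nat -> nat -> R) n N t :
  t \in P n -> (n <= N)%N ->
  schauder_partial P x c N t = schauder_partial P x c n t.
Proof.
move=> tn; elim: N => [|N IH]; first by rewrite leqn0 => /eqP->.
rewrite leq_eqVlt => /predU1P[->//|nN].
rewrite schauder_partial_recr IH// big1 ?addr0// => k _.
rewrite /schauder_fun (schauder_coarse_eq0 (refining_partition N)
  (refining_partition N.+1) (step N)) ?mulr0//; last exact: refining_sub tn.
apply: mem_nth; have := size_refinement_triples (refining_partition N)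
  (refining_partition N.+1) (step N).
by rewrite /refinement_triples /level_triples => ->.
Qed.

Lemma schauder_partial_eq (x : R -> R) (c d : nat -> nat -> R) N t :
  (forall m k, (m < N)%N -> (k < nintervals (P m.+1) - nintervals (P m))%N ->
    c m k = d m k) ->
  schauder_partial P x c N t = schauder_partial P x d N t.
Proof.
move=> cd; congr (_ + _); apply: eq_bigr => m _; apply: eq_bigr => k _.
by rewrite cd.
Qed.

(** Strong induction on the level: on [P m.+1] the lower levels cancel, so the level-[m] combination
    of the differences vanishes there and [schauder_level_free] applies. *)
Lemma schauder_coef_unique (x : R -> R) (c d : nat -> nat -> R) :
  (forall t n, t \in P n ->
    schauder_partial P x c n t = schauder_partial P x d n t) ->
  forall m k, (k < nintervals (P m.+1) - nintervals (P m))%N -> c m k = d m k.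
Proof.
move=> cd; elim/ltn_ind => m IH k km; apply/eqP; rewrite -subr_eq0; apply/eqP.
apply: (schauder_level_free (refining_partition m) (refining_partition m.+1)
  (step m) (fun k => c m k - d m k)) km => t /cd.
rewrite !schauder_partial_recr.
rewrite (schauder_partial_eq _ c d) => [/addrI E|l j lm]; last exact: IH.
under eq_bigr do rewrite mulrBl.
by rewrite sumrB; apply/eqP; rewrite subr_eq0; apply/eqP.
Qed.

Lemma schauder_partial_limit (x : R -> R) (c : nat -> nat -> R) n t :
  (fun N => schauder_partial P x c N t) @ \oo --> x t -> t \in P n ->
  schauder_partial P x c n t = x t.
Proof.
move=> cx tn; apply: cvg_unique cx => //; apply: cvg_near_cst.
by exists n => // N /= nN; exact: schauder_partial_stationary.
Qed.

(** Once the mesh is below the modulus of uniform continuity [d], [x t] is within [eps] of both end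
    values of its interval, hence of the chord. *)
Lemma schauder_partial_uniform (x : R -> R) (eps : R) :
  {within `[0, 1], continuous x} -> 0 < eps -> exists N0 : nat,
  forall N : nat, (N0 <= N)%N -> forall t : R, 0 <= t <= 1 ->
    `| x t - schauder_partial P x (theta P x) N t | < eps.
Proof.
move=> cx e0; have [d d0 xd] := unif_continuous_itv x 0 1 eps cx e0.
have [_ _ _ /cvgrPdist_lt/(_ d d0)[N0 _ meshd] _] := refP.
exists N0 => N N0N t t01.
have [i ip ti] := partition_locate (refining_partition N) t t01.
have cuv := partition_consecutive (refining_partition N) _ ip.
rewrite (schauder_partial_theta _ _ _ _ _ cuv)//.
have [up vp uv _] := cuv.
have mesh_d : nth 0 (P N) i.+1 - nth 0 (P N) i < d.
  apply: le_lt_trans (consecutive_le_mesh (refining_partition N) _ _ cuv) _.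
  have := meshd N N0N; rewrite /= sub0r normrN; apply: le_lt_trans.
  exact: ler_norm.
have [ut tv] := andP ti.
apply: chord_dist_lt => //; apply: xd => //;
  try exact: partition_itv (refining_partition N) _ _;
  by rewrite ltr_norml; lra.
Qed.

End Series.

Theorem mainTheorem3 (R : realType) (P : nat -> seq R) (x : R -> R) :
  finitely_refining P ->
  {within `[0, 1], continuous x} ->
  (* uniform convergence of the partial sums on [0,1] *)
  (forall eps : R, 0 < eps -> exists N0 : nat, forall N : nat, (N0 <= N)%N ->
     forall t : R, 0 <= t <= 1 ->
       `| x t - schauder_partial P x (theta P x) N t | < eps)
  /\
  (* uniqueness of the representation *)
  (forall theta' : nat -> nat -> R,
     (forall t : R, 0 <= t <= 1 ->
        (fun N => schauder_partial P x theta' N t) @ \oo --> x t) ->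
     forall m k : nat, (k < nintervals (P m.+1) - nintervals (P m))%N ->
       theta' m k = theta P x m k).
Proof.
move=> refP cx.
have unif eps := schauder_partial_uniform refP x eps cx.
split=> // theta' cv; apply: (schauder_coef_unique refP x) => t n tn.
have t01 := partition_itv (refining_partition refP n) _ tn.
(* Both series converge to [x] at the partition points, so both partial sums equal [x t]; for
   [theta] the convergence comes from the first half. *)
rewrite !(schauder_partial_limit refP)//; last exact: cv.
apply/cvgrPdist_lt => eps /unif[N0 H].
by exists N0 => // N /= N0N; exact: H.
Qed.
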